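(* Let $p,q\in[1,\infty]$, $\alpha\in\mathbb{R}$, and let $\mathcal{X}$ be either $\mathbb{R}^n$ or a cube $Q_0$ of $\mathbb{R}^n$. Then $f\in\widetilde{JN}_{(p,q,0)_\alpha}(\mathcal{X})$ if and only if $f\in L^q_{\mathrm{loc}}(\mathcal{X})$ and $$\mathrm{B}(f):=\sup\left\{\sum_i|Q_i|^{1-p\alpha}\inf_{c\in[0,\infty)}\|f-c\|^p_{L^q(Q_i,|Q_i|^{-1}dx)}\right\}^{1/p}<\infty,$$ where the infimum is taken over all non-negative real numbers $c$ and the supremum is taken over all collections $\{Q_i\}_i$ of cubes contained in $\mathcal{X}$ with pairwise disjoint interiors. Moreover, there exist positive constants $c_1,c_2$, independent of $f$, such that $c_1\,\mathrm{B}(f)\le\|f\|_{\widetilde{JN}_{(p,q,0)_\alpha}(\mathcal{X})}\le c_2\,\mathrm{B}(f)$ for every $f\in L^q_{\mathrm{loc}}(\mathcal{X})$.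
   Context: A cube in $\mathbb{R}^n$ has finite positive edge length and edges parallel to the coordinate axes; it need not be open or closed. $\mathcal{X}$ denotes either $\mathbb{R}^n$ or a fixed cube $Q_0$ of $\mathbb{R}^n$. Functions are real-valued. $|f|_Q:=\frac1{|Q|}\int_Q|f|$, and $\|g\|_{L^q(Q,|Q|^{-1}dx)}:=[\frac1{|Q|}\int_Q|g|^q]^{1/q}$ (the essential supremum of $|g|$ on $Q$ if $q=\infty$). $L^q_{\mathrm{loc}}(\mathcal{X})$ is the set of measurable $f$ on $\mathcal{X}$ with $f\mathbf 1_E\in L^q(\mathcal{X})$ for every bounded $E\subset\mathcal{X}$. For $f\in L^q_{\mathrm{loc}}(\mathcal{X})$ and $p\in[1,\infty)$, $$\|f\|_{\widetilde{JN}_{(p,q,0)_\alpha}(\mathcal{X})}:=\sup\left\{\sum_i|Q_i|\left[|Q_i|^{-\alpha}\big\|f-|f|_{Q_i}\big\|_{L^q(Q_i,|Q_i|^{-1}dx)}\right]^p\right\}^{1/p},$$ the supremum being over all collections $\{Q_i\}_i$ of cubes contained in $\mathcal{X}$ with pairwise disjoint interiors; for $p=\infty$, $\|f\|_{\widetilde{JN}_{(\infty,q,0)_\alpha}(\mathcal{X})}:=\sup_{Q\subset\mathcal{X}}|Q|^{-\alpha}\big\|f-|f|_Q\big\|_{L^q(Q,|Q|^{-1}dx)}$. $\widetilde{JN}_{(p,q,0)_\alpha}(\mathcal{X})$ is the set of $f\in L^q_{\mathrm{loc}}(\mathcal{X})$ for which this quantity is finite. Likewise, when $p=\infty$, $\mathrm{B}(f)$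 is understood as $\sup_{Q\subset\mathcal{X}}|Q|^{-\alpha}\inf_{c\in[0,\infty)}\|f-c\|_{L^q(Q,|Q|^{-1}dx)}$. *)

(* Defs.v *)
From HB Require Import structures.
From mathcomp Require Import all_boot all_order all_algebra.
From mathcomp Require Import all_classical all_reals all_analysis.

Set Implicit Arguments.
Unset Strict Implicit.
Unset Printing Implicit Defensive.

Import Order.TTheory GRing.Theory Num.Theory.
Import numFieldNormedType.Exports.

Local Open Scope classical_set_scope.
Local Open Scope ring_scope.

(* Lebesgue measure on R^n, n >= 1, with R^n encoded as row vectors of size
   n.+1: the Caratheodory measure of the usual outer measure by half-open
   boxes. It is complete, so measurable means Lebesgue measurable. *)
Section lebesgue_measure_rV.
Local Open Scope ereal_scope.
Context (R : realType) (n : nat).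
Local Notation Rn := 'rV[R]_n.+1.

Definition box (a b : Rn) : set Rn :=
  [set x | forall i, x 0%R i \in `]a 0%R i, b 0%R i]%R].

(* 0 if the box is empty *)
Definition box_volume (a b : Rn) : \bar R :=
  (\prod_i Num.max 0 (b 0 i - a 0 i))%R%:E.

Definition box_cover (A : set Rn) : set (nat -> Rn * Rn) :=
  [set c | A `<=` \bigcup_k box (c k).1 (c k).2].

Definition lebesgue_outer (A : set Rn) : \bar R :=
  ereal_inf [set \sum_(k <oo) box_volume (c k).1 (c k).2 | c in box_cover A].

Lemma box_volume_ge0 a b : 0 <= box_volume a b.
Proof.
by rewrite lee_fin; apply: prodr_ge0 => i _; rewrite le_max lexx.
Qed.

Lemma lebesgue_outer_ge0 A : 0 <= lebesgue_outer A.
Proof.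
apply: le_ereal_inf_tmp => _ [c _ <-].
by apply: nneseries_ge0 => k _ _; exact: box_volume_ge0.
Qed.

Lemma le_lebesgue_outer :
  {homo lebesgue_outer : A B / A `<=` B >-> A <= B}.
Proof.
move=> A B AB; apply/ereal_inf_le_tmp => _ [c Bc <-].
by exists c => //; exact: subset_trans AB Bc.
Qed.

Lemma lebesgue_outer0 : lebesgue_outer set0 = 0.
Proof.
apply/eqP; rewrite eq_le lebesgue_outer_ge0 andbT.
apply: ereal_inf_lbound; exists (fun=> (0%R, 0%R)); first exact: sub0set.
apply: eseries0 => k _ _ /=.
rewrite /box_volume (bigD1 ord0)//= subrr.
by rewrite (_ : Num.max 0 0 = 0)%R ?mul0r// maxxx.
Qed.

Lemma lebesgue_outer_sigma_subadditive : sigma_subadditive lebesgue_outer.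
Proof.
move=> A; have [[i ioo]|] := pselect (exists i, lebesgue_outer (A i) = +oo).
  rewrite (eseries_pinfty _ _ ioo) ?leey// => k _.
  by rewrite -ltNye (lt_le_trans _ (lebesgue_outer_ge0 _)).
rewrite -forallNE => Aoo.
apply/lee_addgt0Pr => _/posnumP[e].
rewrite (le_trans _ (epsilon_trick _ _ _))//; last first.
  by move=> k; exact: lebesgue_outer_ge0.
pose vol (ab : Rn * Rn) := box_volume ab.1 ab.2.
pose P k (c : nat -> Rn * Rn) := box_cover (A k) c /\
  \sum_(j <oo) vol (c j) <=
  lebesgue_outer (A k) + (e%:num / (2 ^ k.+1)%:R)%:E.
have [G PG] : {G : nat -> nat -> Rn * Rn & forall k, P k (G k)}.
  apply: (@choice _ _ P) => k; rewrite /P.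
  have fA : lebesgue_outer (A k) \is a fin_num.
    by rewrite ge0_fin_numE ?lebesgue_outer_ge0// ltey; exact/eqP/Aoo.
  have ek : (0 < e%:num / (2 ^ k.+1)%:R)%R by [].
  have [_ [c Ac <-] /ltW cA] := lb_ereal_inf_adherent ek fA.
  by exists c.
have G_ge0 x : 0 <= (vol \o uncurry G) x by exact: box_volume_ge0.
apply: (@le_trans _ _ (\esum_(i in setT) (vol \o uncurry G) i)).
  apply: ereal_inf_lbound => /=.
  have /card_esym/ppcard_eqP[f] := card_nat2.
  exists (uncurry G \o f).
    move=> t [i _] /(PG i).1 [j _ Gijt]; exists (f^-1%FUN (i, j)) => //=.
    by rewrite invK ?inE.
  rewrite -(esum_pred_image (vol \o uncurry G) _ xpredT) ?[fun=> _]set_true//.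
  by rewrite image_eq.
rewrite (_ : esum _ _ = \sum_(i <oo) \sum_(j <oo ) vol (G i j)); last first.
  pose J : nat -> set (nat * nat) := fun i => [set (i, j) | j in setT].
  rewrite (_ : setT = \bigcup_k J k); last first.
    by rewrite predeqE => -[a b]; split => // _; exists a => //; exists b.
  rewrite esum_bigcupT /=; last 2 first.
  - apply/trivIsetP => i j _ _ ij.
    rewrite predeqE => -[k m] /=; split => //= -[] [_] _ [<-{k} _].
    by move=> [m' _] [] /esym/eqP; rewrite (negbTE ij).
  - by move=> [k m]; exact: box_volume_ge0.
  rewrite -(image_id [set: nat]) -fun_true esum_pred_image//; last first.
    by move=> k _; apply: esum_ge0 => x _; exact: G_ge0.
  apply: eq_eseriesr => /= j _.
  rewrite -(esum_pred_image (vol \o uncurry G) (pair j) predT)//=; last 2 first.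
  - by move=> k _; exact: box_volume_ge0.
  - by move=> ? ? _ _; exact: (@can_inj _ _ _ snd).
  by congr esum; rewrite predeqE => -[a b]; split; move=> [i _ <-]; exists i.
apply: lee_nneseries => k _; last exact: (PG k).2.
by move=> _; apply: nneseries_ge0 => j _ _; exact: box_volume_ge0.
Qed.

HB.instance Definition _ := isOuterMeasure.Build R Rn lebesgue_outer
  lebesgue_outer0 lebesgue_outer_ge0 le_lebesgue_outer
  lebesgue_outer_sigma_subadditive.

(* 'rV[R]_n.+1 equipped with the Lebesgue sigma-algebra *)
Definition leb_rV := caratheodory_type lebesgue_outer.

HB.instance Definition _ := Measurable.on leb_rV.

Definition lebesgue_rV : set leb_rV -> \bar R := lebesgue_outer.

Let lebesgue_rV_sigma_additive : semi_sigma_additive lebesgue_rV.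
Proof. exact: caratheodory_measure_sigma_additive. Qed.

HB.instance Definition _ := isMeasure.Build _ leb_rV R lebesgue_rV
  lebesgue_outer0 lebesgue_outer_ge0 lebesgue_rV_sigma_additive.

End lebesgue_measure_rV.

Arguments lebesgue_outer {R n}.
Arguments lebesgue_rV {R n}.

Section cubes.
Context (R : realType) (n : nat).
Local Notation Rn := 'rV[R]_n.+1.

(* The booleans decide, for each face, whether it is included. *)
Definition is_cube (Q : set Rn) : Prop :=
  exists (a : Rn) (l : R) (bl br : 'I_n.+1 -> bool), 0 < l /\
    Q = [set x | forall i,
      x 0 i \in Interval (BSide (bl i) (a 0 i)) (BSide (br i) (a 0 i + l))].

Definition cubes_in (X : set Rn) : set (set Rn) :=
  [set Q | is_cube Q /\ Q `<=` X].

(* Cubes with disjoint interiors are distinct, as these interiors are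
   nonempty: families of such cubes are the same as sets of such cubes. *)
Definition cube_packing (X : set Rn) : set (set (set Rn)) :=
  [set C | C `<=` cubes_in X /\ trivIset C (@interior Rn)].

End cubes.

Section JN.
Local Open Scope ereal_scope.
Context (R : realType) (n : nat).
Local Notation Rn := 'rV[R]_n.+1.
Local Notation T := (leb_rV R n).
Local Notation leb := (@lebesgue_rV R n).
Implicit Types (X Q E : set Rn) (f g : Rn -> R) (p q : \bar R) (alpha : R).

Definition in_Lq q X g : Prop :=
  measurable_fun (X : set T) (g : T -> R) /\ finite_norm leb q (g \_ X : T -> R).

(* E has to be measurable for f 1_E to be measurable *)
Definition in_Lq_loc q X f : Prop :=
  measurable_fun (X : set T) (f : T -> R) /\
  forall E, E `<=` X -> bounded_set E -> measurable (E : set T) ->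
    in_Lq q X (f \* \1_E)%R.

Lemma inv_measure_ge0 Q : (0 <= (fine (leb Q))^-1)%R.
Proof. by rewrite invr_ge0 fine_ge0// measure_ge0. Qed.

(* the measure |Q|^-1 dx *)
Definition leb_avg Q : {measure set T -> \bar R} :=
  mscale (NngNum (inv_measure_ge0 Q)) leb.

(* the norm of L^q(Q, |Q|^-1 dx) *)
Definition Lq_avg q Q g : \bar R := 'N[leb_avg Q]_q[EFin \o (g \_ Q)].

(* |f|_Q *)
Definition mean_abs f Q : R :=
  ((fine (leb Q))^-1 * \int[leb]_(x in (Q : set T)) `|f x|)%R.

Definition JN_norm p q alpha X f : \bar R :=
  match p with
  | r%:E => (ereal_sup [set
      \esum_(Q in C) (leb Q *
        (leb Q `^ (- alpha) * Lq_avg q Q (fun x => f x - mean_abs f Q)%R) `^ r)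
      | C in cube_packing X]) `^ r^-1
  | _ => ereal_sup [set
      leb Q `^ (- alpha) * Lq_avg q Q (fun x => f x - mean_abs f Q)%R
      | Q in cubes_in X]
  end.

Definition in_JN p q alpha X f : Prop :=
  in_Lq_loc q X f /\ JN_norm p q alpha X f < +oo.

Definition JN_B p q alpha X f : \bar R :=
  match p with
  | r%:E => (ereal_sup [set
      \esum_(Q in C) (leb Q `^ (1 - r * alpha) *
        ereal_inf [set Lq_avg q Q (fun x => f x - c)%R `^ r
                  | c in [set c : R | (0 <= c)%R]])
      | C in cube_packing X]) `^ r^-1
  | _ => ereal_sup [set
      leb Q `^ (- alpha) *
        ereal_inf [set Lq_avg q Q (fun x => f x - c)%R
                  | c in [set c : R | (0 <= c)%R]]
      | Q in cubes_in X]
  end.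

End JN.

(* Main.v *)
(* On a cube Q put the probability measure dx/|Q|. For c >= 0,
   | c - |f|_Q | <= avg_Q | f - c | <= ||f - c||_q by Hoelder's inequality, so
   ||f - |f|_Q||_q <= 2 ||f - c||_q by Minkowski's; conversely |f|_Q is itself
   an admissible c. Comparing the two quantities cube by cube gives the theorem
   with c1 = 1 and c2 = 2. *)
Require Import Defs.
From HB Require Import structures.
From mathcomp Require Import all_boot all_order all_algebra.
From mathcomp Require Import all_classical all_reals all_analysis.
From mathcomp Require Import ess_sup_inf measurable_realfun lra.

Set Implicit Arguments.
Unset Strict Implicit.
Unset Printing Implicit Defensive.

Import Order.TTheory GRing.Theory Num.Theory.
Import numFieldNormedType.Exports.

Local Open Scope classical_set_scope.
Local Open Scope ring_scope.
Local Open Scope ereal_scope.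

(** * Lebesgue measurability of cubes *)

Section measurable_cubes.
Context (R : realType) (n : nat).
Local Notation Rn := 'rV[R]_n.+1.
Local Notation T := (leb_rV R n).
Implicit Types (a b : Rn) (i : 'I_n.+1) (t : R).

(** The hyperplane x_i = t cuts the box []a, b]] into []a, lower i t b]] and []upper i t a, b]],
    half-open again and possibly empty. *)
Let lower i t b : Rn :=
  (\row_j if j == i then Num.min (b 0 j) t else b 0 j)%R.

Let upper i t a : Rn :=
  (\row_j if j == i then Num.max (a 0 j) t else a 0 j)%R.

(** Only the i-th edge changes, so the other factors come out as [P]. Truncating edge lengths at 0
    keeps the identity true when t lies outside the edge. *)
Lemma box_volume_split i t a b :
  box_volume a (lower i t b) + box_volume (upper i t a) b = box_volume a b.
Proof.
rewrite /box_volume -EFinD (bigD1 i)//= [X in (_ + X)%R](bigD1 i)//=.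
rewrite [in RHS](bigD1 i)//= !mxE eqxx.
set P := (\prod_(j < n.+1 | j != i) Num.max 0 (b 0 j - a 0 j))%R.
rewrite [X in (_ * X + _)%R](_ : _ = P); last first.
  by apply: eq_bigr => j /negPf ji; rewrite !mxE ji.
rewrite [X in (_ + _ * X)%R](_ : _ = P); last first.
  by apply: eq_bigr => j /negPf ji; rewrite !mxE ji.
rewrite -mulrDl; congr (_ * _)%:E.
rewrite /Num.max /Num.min; do !case: ifPn; rewrite -?leNgt; lra.
Qed.

(** Cutting each box of a cover of [A] along x_i = t covers the two parts of [A] with the same total
    volume. *)
Lemma caratheodory_halfspace i t :
  caratheodory_measurable (@lebesgue_outer R n) [set x | (x 0 i <= t)%R].
Proof.
apply: le_caratheodory_measurable => A.
apply: le_ereal_inf_tmp => _ [c Ac <-].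
under eq_eseriesr do rewrite -(box_volume_split i t).
rewrite nneseriesD; [|by move=> *; exact: box_volume_ge0..].
apply: leeD; apply: ereal_inf_lbound.
- exists (fun k => ((c k).1, lower i t (c k).2)) => //= x [/Ac[k _ xk] xt].
  exists k => // j; rewrite /= mxE; have := xk j.
  by case: eqP => [->|//]; rewrite !in_itv/= le_min => /andP[-> ->].
- exists (fun k => (upper i t (c k).1, (c k).2)) => //= x [/Ac[k _ xk] xt].
  exists k => // j; rewrite /= mxE; have := xk j.
  case: eqP => [->|//]; rewrite !in_itv/= gt_max => /andP[-> ->].
  by rewrite andbT; move/negP: xt; rewrite -ltNge => ->.
Qed.

Lemma measurable_coord i : measurable_fun setT (fun x : T => (x : Rn) 0%R i).
Proof.
(* Open rays to +oo generate the Borel sets, and their preimages are complements of closed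
   half-spaces. *)
apply: (measurability _ (RGenOInfty.measurableE R)) => _ [_ [t ->] <-].
rewrite setTI preimage_itvoy -[X in measurable X]setCK; apply: measurableC.
rewrite (_ : ~` _ = [set x : T | ((x : Rn) 0 i <= t)%R]).
  exact: caratheodory_halfspace.
by apply/seteqP; split => x /=; rewrite leNgt => /negP.
Qed.

Lemma measurable_cube (Q : set Rn) : is_cube Q -> measurable (Q : set T).
Proof.
move=> [a [l [bl [br [_ ->]]]]].
pose I i := Interval (BSide (bl i) (a 0%R i)) (BSide (br i) (a 0%R i + l)%R).
rewrite [X in measurable X](_ : _ = \bigcap_(i in [set: 'I_n.+1])
    ((fun x : T => (x : Rn) 0%R i) @^-1` [set` I i])); last first.
  by apply/seteqP; split => [x Qx i _|x Qx i]; [exact: Qx|exact: (Qx i)].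
apply: fin_bigcap_measurable => // i _; rewrite -[X in measurable X]setTI.
by apply: measurable_coord => //; exact: measurable_itv.
Qed.

End measurable_cubes.

(** * Oscillation on a set of mass one *)

Section oscillation.
Context d (T : measurableType d) (R : realType).
Context (mu : {measure set T -> \bar R}).
Context (D : set T) (mD : measurable D) (muD : mu D = 1).
Implicit Types (f g : T -> R) (q : \bar R) (c k : R).

(** For q = +oo the norm is an essential supremum only when [mu setT] is positive, and 0 by
    convention otherwise. *)
Let muT_gt0 : 0 < mu setT.
Proof.
apply: (@lt_le_trans _ _ (mu D)); first by rewrite muD.
by apply: le_measure; rewrite ?inE.
Qed.

Let measurable_restrictD g :
  measurable_fun D g -> measurable_fun setT (g \_ D).
Proof. exact: (measurable_restrictT _ mD).1. Qed.

Lemma Lnorm_cst_restrict_le q k : 1 <= q ->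
  'N[mu]_q[EFin \o (cst k \_ D)] <= `|k|%:E.
Proof.
rewrite unlock; case: q => [r|_|//].
- rewrite lee_fin => r1; have r0 : (r != 0)%R by lra.
  rewrite (_ : \int[mu]_x _ = (`|k| `^ r)%:E).
    by rewrite poweR_EFin -powRrM mulfV// powRr1.
  transitivity (\int[mu]_(x in D) cst (`|k| `^ r)%:E x).
    rewrite [RHS]integral_mkcond; apply: eq_integral => x _ /=.
    by rewrite !patchE; case: ifP => _ //; rewrite normr0 powR0.
  by rewrite integral_cst// muD mule1.
- rewrite muT_gt0; apply/ess_supP; apply: nearW => x /=.
  by rewrite lee_fin patchE; case: ifP => _; rewrite ?normr0.
Qed.

(** For 1 < q < +oo, Hoelder's inequality against the indicator of [D], whose norm is at most 1. For
    q = +oo, integrate the essential bound over [D]. *)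
Lemma Lnorm1_restrict_le q g : measurable_fun D g -> 1 <= q ->
  'N[mu]_1[EFin \o (g \_ D)] <= 'N[mu]_q[EFin \o (g \_ D)].
Proof.
move=> mg; have {}mg : measurable_fun setT (g \_ D).
  exact: measurable_restrictD.
case: q => [r|_|//].
- rewrite lee_fin le_eqVlt => /predU1P[<-//|r1].
  have r0 : (0 < r)%R by lra.
  (* The conjugate exponent, finite because r = 1 has been set aside. *)
  pose r' := (1 - r^-1)^-1%R.
  have r'0 : (0 < r')%R by rewrite invr_gt0 subr_gt0 invf_lt1.
  have m1 : measurable_fun setT (cst (1 : R)%R \_ D).
    exact: measurable_restrictD.
  have rr' : (r^-1 + r'^-1 = 1)%R by rewrite invrK; lra.
  have := hoelder mu mg m1 r0 r'0 rr'.
  rewrite (_ : (_ \* _)%R = g \_ D); last first.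
    apply/funext => x /=; rewrite !patchE.
    by case: ifP => _; rewrite (mulr1, mulr0).
  move=> /le_trans; apply; rewrite -[leRHS]mule1.
  apply: lee_wpmul2l; first exact: Lnorm_ge0.
  have r'1 : 1 <= r'%:E.
    by rewrite lee_fin invf_ge1 ?subr_gt0 ?invf_lt1// gerBl invr_ge0 ltW.
  by have := Lnorm_cst_restrict_le 1 r'1; rewrite normr1.
- rewrite Lnorm1 unlock muT_gt0; set M := ess_sup _ _.
  apply: (@le_trans _ _ (\int[mu]_(x in D) cst M x)); last first.
    by rewrite integral_cst// muD mule1.
  rewrite [leRHS]integral_mkcond.
  have M0 : 0 <= M.
    by apply: ess_sup_gee => //; apply: nearW => x /=; rewrite lee_fin.
  apply: ae_ge0_le_integral => //.
  + by do 2 apply: measurableT_comp => //.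
  + by move=> x _; rewrite patchE; case: ifP.
  + exact: (measurable_restrictT (cst M) mD).1.
  + have := ess_sup_ge mu (abse \o (EFin \o g \_ D)).
    apply: filterS => x xM _; rewrite [leRHS]patchE.
    by case: ifPn => // xD; rewrite /= patchE (negPf xD) normr0.
Qed.

(** Stated for a measure giving mass 1 to [D] but arbitrary outside, so as to apply to [leb_avg Q],
    which lives on the whole space; hence the restrictions to [D]. *)
Lemma Lnorm_sub_mean_abs q f c : measurable_fun D f -> 1 <= q -> (0 <= c)%R ->
  'N[mu]_q[EFin \o ((fun x => f x - \int[mu]_(y in D) `|f y|)%R \_ D)] <=
  2%:E * 'N[mu]_q[EFin \o ((fun x => f x - c)%R \_ D)].
Proof.
move=> mf q1 c0; set m := (\int[mu]_(y in D) _)%R.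
set N := 'N[mu]_q[EFin \o ((fun x => f x - c)%R \_ D)].
have mfc : measurable_fun D (fun x => f x - c)%R by exact: measurable_funB.
(* If [N] is +oo, so is the right-hand side. Otherwise f - c, and with it f, is integrable on [D],
   so real integrals are linear below. *)
have : N <= +oo by exact: leey.
rewrite le_eqVlt => /predU1P[->|Noo]; first by rewrite gt0_muley ?leey.
have intN : \int[mu]_(x in D) `|f x - c|%:E <= N.
  apply: le_trans (Lnorm1_restrict_le mfc q1).
  rewrite Lnorm1 integral_mkcond le_eqVlt; apply/predU1P; left.
  apply: eq_integral => x _; rewrite /= !patchE.
  by case: ifP; rewrite //= normr0.
have ifc : mu.-integrable D (EFin \o (fun x => f x - c)%R).
  apply/integrableP; split; first exact/measurable_EFinP.
  exact: le_lt_trans intN Noo.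
have ic : mu.-integrable D (EFin \o cst c).
  apply/integrableP; split; first exact: (measurable_cst c%:E).
  by rewrite (eq_integral (cst `|c|%:E))// integral_cst// muD mule1 ltry.
have if_ : mu.-integrable D (EFin \o f).
  apply: eq_integrable (integrableD mD ifc ic) => // x _ /=.
  by rewrite -EFinD subrK.
have iaf : mu.-integrable D (EFin \o (fun x => `|f x|)%R).
  exact: integrable_norm.
(* c - m is the mean of c - |f| over [D], so it is bounded by the mean of |f - c|. *)
have cm : `|c - m|%:E <= N.
  apply: le_trans intN.
  have -> : (c - m = \int[mu]_(x in D) (c - `|f x|))%R.
    by rewrite RintegralB// Rintegral_cst// muD mulr1.
  have icaf : mu.-integrable D (EFin \o (fun x => c - `|f x|)%R).
    by apply: eq_integrable (integrableB mD ic iaf).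
  rewrite -abse_EFin /Rintegral fineK; last exact: integrable_fin_num.
  apply: le_trans (le_abse_integral _ _ _) _ => //.
    exact: measurable_int icaf.
  apply: ge0_le_integral => //.
  - by apply: measurableT_comp => //; exact: measurable_int icaf.
  - by do 2 apply: measurableT_comp => //.
  (* The sign of c enters here: c = |c|, so the reverse triangle inequality applies. *)
  - move=> x Dx /=; rewrite lee_fin -[in leLHS](ger0_norm c0) (distrC (f x)).
    exact: ler_dist_dist.
(* Minkowski's inequality for f - m = (f - c) + (c - m); each summand has norm at most [N]. *)
rewrite (_ : _ \_ D = ((fun x => f x - c) \_ D \+ cst (c - m) \_ D)%R);
    last first.
  apply/funext => x /=; rewrite !patchE.
  by case: ifP => _ /=; rewrite ?addr0// subrKA.
apply: le_trans (eminkowski _ _ _ q1) _; try exact: measurable_restrictD.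
rewrite -[2%:E]/(1 + 1)%:E EFinD ge0_muleDl ?mul1e//; apply: leeD => //.
by apply: le_trans cm; exact: Lnorm_cst_restrict_le.
Qed.

End oscillation.

(** * Sums, infima and powers of extended reals *)

Lemma esum_pZl (R : realType) (I : choiceType) (D : set I) (a : I -> \bar R)
    (k : R) : (0 < k)%R -> (forall i, 0 <= a i) ->
  \esum_(i in D) (k%:E * a i) = k%:E * \esum_(i in D) a i.
Proof.
move=> k0 a0; rewrite /esum -ereal_sup_pZl// image_comp; congr ereal_sup.
apply: eq_imagel => F [finF FD] /=.
by rewrite ge0_mule_fsumr.
Qed.

Lemma ereal_inf_image_ge0 (R : realType) (I : Type) (D : set I)
    (F : I -> \bar R) :
  (forall i, 0 <= F i) -> 0 <= ereal_inf [set F i | i in D].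
Proof. by move=> F0; apply: le_ereal_inf_tmp => _ [i _ <-]. Qed.

(** Reconciles the weight in [JN_norm] with that in [JN_B]. As [fine v != 0] makes v finite and
    nonzero, exponents of v add. *)
Lemma mule_poweR_weight (R : realType) (v x : \bar R) (r alpha : R) :
    fine v != 0%R -> 0 <= v -> 0 <= x ->
  v * (v `^ (- alpha) * x) `^ r = v `^ (1 - r * alpha) * x `^ r.
Proof.
move=> v0 vge0 x0; rewrite poweRM ?poweR_ge0// muleA -poweRrM; congr (_ * _).
have -> : v = (fine v)%:E.
  by rewrite fineK//; move: v0; case: (v); rewrite //= eqxx.
rewrite mulNr mulrC !poweR_EFin -EFinM powRD ?v0 ?implybT//.
by rewrite powRr1 ?fine_ge0.
Qed.

(** * Comparison on each cube, then over packings *)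

Section cube_oscillation.
Context (R : realType) (n : nat).
Local Notation Rn := 'rV[R]_n.+1.
Local Notation T := (leb_rV R n).
Local Notation leb := (@lebesgue_rV R n).
Implicit Types (X Q : set Rn) (f g : Rn -> R) (p q : \bar R) (alpha c : R).

Lemma Lq_avg_ge0 q Q g : 0 <= Lq_avg q Q g.
Proof. exact: Lnorm_ge0. Qed.

Lemma mean_abs_ge0 f Q : (0 <= mean_abs f Q)%R.
Proof. by rewrite mulr_ge0 ?inv_measure_ge0// fine_ge0 ?integral_ge0. Qed.

(* Here fine (leb Q) = 0 means |Q| = 0 or |Q| = +oo: all averages then vanish,
   so that we need not prove that cubes have positive finite measure. *)
Lemma Lq_avg_degenerate q Q g : 1 <= q -> fine (leb Q) = 0%R ->
  Lq_avg q Q g = 0.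
Proof.
move=> q1 Q0.
have avg0 A : leb_avg Q A = 0 by rewrite /= /mscale /= Q0 invr0 mul0e.
rewrite /Lq_avg unlock; case: q q1 => [r|_|//].
- rewrite lee_fin => r1.
  rewrite (@eq_measure_integral _ _ _ _ mzero); last first.
    by move=> A _ _; exact: avg0.
  by rewrite integral_measure_zero poweR0r// invr_eq0; lra.
- by rewrite avg0 ltxx.
Qed.

Lemma Lq_avg_sub_mean_abs q Q f c :
    measurable (Q : set T) -> measurable_fun (Q : set T) (f : T -> R) ->
    1 <= q -> (0 <= c)%R ->
  Lq_avg q Q (fun x => f x - mean_abs f Q)%R <=
  2%:E * Lq_avg q Q (fun x => f x - c)%R.
Proof.
move=> mQ mf q1 c0.
have [Q0|Q0] := eqVneq (fine (leb Q)) 0%R.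
  by rewrite !Lq_avg_degenerate// mule0.
have avgQ : leb_avg Q (Q : set T) = 1.
  have Qfin : leb Q \is a fin_num.
    by move: Q0; case: (leb Q) => //=; rewrite eqxx.
  by rewrite /= /mscale /= -[X in _ * X]fineK// -EFinM mulVf.
rewrite (_ : mean_abs f Q = \int[leb_avg Q]_(x in (Q : set T)) `|f x|)%R.
  exact: Lnorm_sub_mean_abs.
rewrite /mean_abs /Rintegral ge0_integral_mscale//=; last first.
  apply/measurable_EFinP.
  exact: (measurableT_comp (@normr_measurable R setT)).
have : 0 <= \int[leb]_(x in (Q : set T)) `|f x|%:E by exact: integral_ge0.
case: (integral _ _ _) => [s _|_|//]; first by [].
(* When |f| has infinite integral, both sides are 0, the value of [fine] at infinities. *)
by rewrite mulr_infty; case: sgrP => _; rewrite ?mul0e ?mul1e ?mulN1e ?mulr0.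
Qed.

Let JN_osc alpha q f Q :=
  leb Q `^ (- alpha) * Lq_avg q Q (fun x => f x - mean_abs f Q)%R.

Let B_osc q f Q :=
  ereal_inf [set Lq_avg q Q (fun x => f x - c)%R
            | c in [set c : R | (0 <= c)%R]].

Let JN_term r alpha q f Q :=
  leb Q * JN_osc alpha q f Q `^ r.

Let B_term r alpha q f Q :=
  leb Q `^ (1 - r * alpha) *
    ereal_inf [set Lq_avg q Q (fun x => f x - c)%R `^ r
              | c in [set c : R | (0 <= c)%R]].

(** The r-th power sits inside the infimum, so the bound with factor 2 is raised to the power r for
    each c separately. *)
Lemma JN_term_bounds r alpha q f Q :
    measurable (Q : set T) -> measurable_fun (Q : set T) (f : T -> R) ->
    (1 <= r)%R -> 1 <= q ->
  B_term r alpha q f Q <= JN_term r alpha q f Q <=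
  (2 `^ r)%:E * B_term r alpha q f Q.
Proof.
move=> mQ mf r1 q1; have r0 : (0 < r)%R by lra.
have rN0 : (r != 0)%R by rewrite gt_eqF.
pose m := mean_abs f Q; have m0 : (0 <= m)%R := mean_abs_ge0 f Q.
rewrite /B_term /JN_term /JN_osc; set I := ereal_inf _.
have IN : I <= Lq_avg q Q (fun x => f x - m)%R `^ r.
  by apply: ereal_inf_lbound; exists m.
have I0 : 0 <= I by apply: ereal_inf_image_ge0 => c; exact: poweR_ge0.
(* In the degenerate case the weights need not agree, but both terms are 0. *)
have [Q0|Q0] := eqVneq (fine (leb Q)) 0%R.
  suff -> : I = 0 by rewrite Lq_avg_degenerate// !mule0 poweR0r// mule0 lexx.
  apply/eqP; rewrite eq_le I0 andbT (le_trans IN)//.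
  by rewrite Lq_avg_degenerate// poweR0r.
rewrite mule_poweR_weight ?measure_ge0 ?Lq_avg_ge0//.
rewrite muleCA; apply/andP; split; apply: lee_wpmul2l; rewrite ?poweR_ge0//.
rewrite -ereal_inf_pZl ?powR_gt0//.
apply: le_ereal_inf_tmp => _ [_ [c c0 <-] <-].
rewrite -poweR_EFin -poweRM ?Lq_avg_ge0//.
apply: gt0_ler_poweR; first exact: ltW.
- by rewrite in_itv/= leey Lq_avg_ge0.
- by rewrite in_itv/= leey mule_ge0 ?Lq_avg_ge0.
- exact: Lq_avg_sub_mean_abs.
Qed.

Lemma JN_osc_bounds alpha q f Q :
    measurable (Q : set T) -> measurable_fun (Q : set T) (f : T -> R) ->
    1 <= q ->
  leb Q `^ (- alpha) * B_osc q f Q <= JN_osc alpha q f Q <=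
  2%:E * (leb Q `^ (- alpha) * B_osc q f Q).
Proof.
move=> mQ mf q1; rewrite /JN_osc muleCA.
apply/andP; split; apply: lee_wpmul2l; rewrite ?poweR_ge0//.
  by apply: ereal_inf_lbound; exists (mean_abs f Q) => //; exact: mean_abs_ge0.
rewrite -ereal_inf_pZl//; apply: le_ereal_inf_tmp => _ [_ [c c0 <-] <-].
exact: Lq_avg_sub_mean_abs.
Qed.

Lemma JN_norm_bounds p q alpha X f :
    measurable (X : set T) -> measurable_fun (X : set T) (f : T -> R) ->
    1 <= p -> 1 <= q ->
  JN_B p q alpha X f <= JN_norm p q alpha X f <= 2%:E * JN_B p q alpha X f.
Proof.
move=> mX mf p1 q1.
have mcube Q : cubes_in X Q ->
    measurable (Q : set T) /\ measurable_fun (Q : set T) (f : T -> R).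
  move=> [/measurable_cube mQ QX]; split => //; exact: measurable_funS mf.
case: p p1 => [r|_|//].
- rewrite lee_fin => r1; have r0 : (0 < r)%R by lra.
  have bounds C Q : cube_packing X C -> C Q ->
      B_term r alpha q f Q <= JN_term r alpha q f Q <=
      (2 `^ r)%:E * B_term r alpha q f Q.
    by move=> [CX _] /CX/mcube[mQ mfQ]; exact: JN_term_bounds.
  (* The empty packing contributes the sum 0. *)
  have sup_ge0 (t : set Rn -> \bar R) :
      0 <= ereal_sup [set \esum_(Q in C) t Q | C in cube_packing X].
    apply: ereal_sup_ubound; exists set0; last by rewrite esum_set0.
    by split=> //; exact: trivIset_set0.
  have B0 Q : 0 <= B_term r alpha q f Q.
    rewrite mule_ge0 ?poweR_ge0//.
    by apply: ereal_inf_image_ge0 => c; exact: poweR_ge0.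
  have le_root (x y : \bar R) : 0 <= x -> x <= y -> x `^ r^-1 <= y `^ r^-1.
    move=> x0 xy; apply: gt0_ler_poweR => //; first by rewrite invr_ge0 ltW.
      by rewrite in_itv/= x0 leey.
    by rewrite in_itv/= (le_trans x0 xy) leey.
  rewrite /JN_B /JN_norm.
  (* With 2 written as an r-th root, both bounds reduce to comparing suprema before the root is
     taken. *)
  have -> : 2%:E = (2 `^ r)%:E `^ r^-1 :> \bar R.
    by rewrite poweR_EFin -powRrM mulfV ?gt_eqF// powRr1.
  rewrite -poweRM ?sup_ge0 ?lee_fin ?powR_ge0//.
  apply/andP; split; apply: le_root => //; apply: ge_ereal_sup => _ [C CX <-].
  + apply: (@le_trans _ _ (\esum_(Q in C) JN_term r alpha q f Q)).
      by apply: le_esum => Q /(bounds _ _ CX)/andP[].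
    by apply: ereal_sup_ubound; exists C.
  + apply: (@le_trans _ _
        (\esum_(Q in C) ((2 `^ r)%:E * B_term r alpha q f Q))).
      by apply: le_esum => Q /(bounds _ _ CX)/andP[].
    rewrite esum_pZl ?powR_gt0//; apply: lee_wpmul2l.
      by rewrite lee_fin powR_ge0.
    by apply: ereal_sup_ubound; exists C.
- have bounds Q : cubes_in X Q ->
      leb Q `^ (- alpha) * B_osc q f Q <= JN_osc alpha q f Q <=
      2%:E * (leb Q `^ (- alpha) * B_osc q f Q).
    by move=> /mcube[mQ mfQ]; exact: JN_osc_bounds.
  apply/andP; split; apply: ge_ereal_sup => _ [Q QX <-].
  + have /andP[le1 _] := bounds Q QX; apply: le_trans le1 _.
    by apply: ereal_sup_ubound; exists Q.
  + have /andP[_ le2] := bounds Q QX; apply: le_trans le2 _.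
    by apply: lee_wpmul2l => //; apply: ereal_sup_ubound; exists Q.
Qed.

End cube_oscillation.

(** * Equivalence of finiteness and of norms *)

Theorem proposition3p8 (R : realType) (n : nat) (p q : \bar R) (alpha : R)
    (X : set 'rV[R]_n.+1) (hp : 1 <= p) (hq : 1 <= q)
    (hX : X = setT \/ is_cube X) :
  (forall f : 'rV[R]_n.+1 -> R,
     in_JN p q alpha X f <-> in_Lq_loc q X f /\ JN_B p q alpha X f < +oo) /\
  (exists c1 c2 : R, (0 < c1)%R /\ (0 < c2)%R /\
     forall f : 'rV[R]_n.+1 -> R, in_Lq_loc q X f ->
       c1%:E * JN_B p q alpha X f <= JN_norm p q alpha X f /\
       JN_norm p q alpha X f <= c2%:E * JN_B p q alpha X f).
Proof.
have mX : measurable (X : set (leb_rV R n)).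
  by case: hX => [->|]; [exact: measurableT|exact: measurable_cube].
have bounds f : in_Lq_loc q X f ->
    JN_B p q alpha X f <= JN_norm p q alpha X f <= 2%:E * JN_B p q alpha X f.
  by move=> [mf _]; exact: JN_norm_bounds.
split=> [f|].
  split=> -[fq foo]; split=> //; have /andP[le1 le2] := bounds f fq.
    exact: le_lt_trans le1 foo.
  by apply: le_lt_trans le2 _; rewrite lte_mul_pinfty.
exists 1%R, 2%R; split; [by []|split; first by []].
by move=> f /bounds/andP[]; rewrite mul1e.
Qed.
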